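(* In the multiclass queue described in the context, assume $\rho(\mathbf{M})\le 1$. Let $g_i(\theta)=\mathbb{E}[e^{-\theta B_i}]$ and $g_{i,s}(\theta)=\mathbb{E}[e^{-\theta B_{i,s}}]$. Then for $\theta\ge 0$, $s\ge0$ and $i=1,\dots,K$, $$g_{i,s}(\theta)=\exp\Bigl\{-s\Bigl(\theta+\bar\lambda^i-\sum_{j=1}^K\lambda_{ij}g_j(\theta)\Bigr)\Bigr\}.$$ Further, $$g_i(\theta)=\psi_i\Bigl(\theta+\bar\lambda^i-\sum_{j=1}^K\lambda_{ij}g_j(\theta)\Bigr),\qquad i=1,\dots,K,\qquad(\ast)$$ and the vector $(g_1(\theta),\dots,g_K(\theta))$ is the minimal non-negative and non-increasing solution of the system $(\ast)$; that is, $g_1,\dots,g_K$ are non-negative and non-increasing in $\theta$, solve $(\ast)$, and any other non-negative non-increasing solution $(\widetilde g_1,\dots,\widetilde g_K)$ of $(\ast)$ satisfies $g_i(\theta)\le\widetilde g_i(\theta)$ for all $i$ and all $\theta\ge0$.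
   Context: Queue. A single server serves jobs of $K$ classes, one at a time, under a non-idling policy. Class $i$ service times are i.i.d., distributed as $S_i\geq 0$ with distribution $F_i$ and mean $\mathbb{E}S_i=1/\mu_i\in(0,\infty)$; $\psi_i(u)=\mathbb{E}[e^{-uS_i}]=\int_0^\infty e^{-ut}\,dF_i(t)$. While a class $i$ job is in service, class $j$ jobs arrive according to a Poisson process of rate $\lambda_{ij}\ge 0$, all these processes being independent of each other and of the service times. Set $\bar\lambda^i=\sum_{j=1}^K\lambda_{ij}$ and let $\mathbf{M}$ be the $K\times K$ matrix with entries $M_{ij}=\lambda_{ij}/\mu_i$, assumed irreducible, with spectral radius $\rho(\mathbf{M})$. $B_i$ is the busy period (time until the system becomes empty) when the system starts with a single class $i$ customer, beginning service, with service time $S_i$; $B_{i,s}$ is the busy period when the system starts with a single class $i$ customer whose remaining service time is $s$. The distributions of these do not depend on the non-idling policy: equivalently, $B_i$ is the sum of the lifetimes of all individuals in a $K$-type branching process started from one type $i$ individual, where a type $k$ individual has lifetime distributed as $S_k$ and, given its lifetime $s$, independently has Poisson$(\lambda_{kj}s)$ children of type $j$, $j=1,\dots,K$; $B_{i,s}$ is the same with the ancestor's lifetime fixed to be $s$. *)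

(* Defs.v *)
From mathcomp Require Import all_boot all_order all_algebra.
From mathcomp Require Import all_classical all_reals all_analysis.
From mathcomp Require Import complex.

Set Implicit Arguments.
Unset Strict Implicit.
Unset Printing Implicit Defensive.

Import Order.TTheory GRing.Theory Num.Theory.
Import numFieldNormedType.Exports.

Local Open Scope classical_set_scope.
Local Open Scope ring_scope.

(* n = 0 is harmless off the diagonal, and makes every 1 x 1 matrix, including
   0, irreducible, as for irreducibility up to permutation to block triangular
   form. *)
Definition irreducible_mx (R : realType) (K : nat) (M : 'M[R]_K) : Prop :=
  forall i j : 'I_K, exists n : nat, 0 < (M ^+ n) i j.

Definition spectral_radius (R : realType) (K : nat) (M : 'M[R]_K) : R :=
  sup [set r : R | exists2 z : R[i],
    eigenvalue (map_mx (real_complex R) M) z & r = ComplexField.Normc.normc z].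

Definition offspring_mean_mx (R : realType) (K : nat)
    (lambda : 'I_K -> 'I_K -> R) (mu : 'I_K -> R) : 'M[R]_K :=
  \matrix_(i, j) (lambda i j / mu i).

(* The library's [poisson_pmf r k] equals 1 for every k when r = 0; rate 0 does
   occur here, and has to give the unit mass at 0 (recall 0 ^+ 0 = 1). *)
Definition poisson_mass (R : realType) (r : R) (k : nat) : R :=
  r ^+ k / k`!%:R * expR (- r).

(* Genealogical labels, youngest generation first: [::] is the ancestor and
   (j, m) :: u is the m-th (m = 0, 1, ...) type j child of u. *)
Definition label (K : nat) : Type := seq ('I_K * nat).

Definition label_type (K : nat) (i : 'I_K) (u : label K) : 'I_K :=
  if u is (j, _) :: _ then j else i.

Fixpoint label_born (K : nat) (kids : label K -> 'I_K -> nat) (u : label K)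
    : bool :=
  if u is (j, m) :: v then label_born kids v && (m < kids v j)%N else true.

Definition mark_event (R : realType) (K : nat) (T : Type)
    (life : label K -> T -> R) (kids : label K -> 'I_K -> T -> nat)
    (u : label K) (A : set R) (C : set ('I_K -> nat)) : set T :=
  [set w | A (life u w) /\ C (fun j => kids u j w)].

(* K-type branching process started from one type i individual whose lifetime
   has law F0; type k individuals other than the ancestor have lifetime law
   F k.  Every label u, whether born or not, carries a mark: a lifetime and,
   for each j, a number of type j children. *)
Record branching_process (R : realType) (K : nat)
    (lambda : 'I_K -> 'I_K -> R) (F : 'I_K -> probability (measurableTypeR R) R)
    (i : 'I_K) (F0 : probability (measurableTypeR R) R) := BranchingProcess {
  bp_disp : measure_display ;
  bp_space : measurableType bp_disp ;
  bp_prob : probability bp_space R ;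
  bp_life : label K -> bp_space -> R ;
  bp_kids : label K -> 'I_K -> bp_space -> nat ;
  bp_life_measurable : forall u, measurable_fun setT (bp_life u) ;
  bp_kids_measurable : forall u j, measurable_fun setT (bp_kids u j) ;
  bp_life_ge0 : forall u w, 0 <= bp_life u w ;
  (* the lifetime of u has the prescribed law and, given that it equals s, the
     numbers of children are independent, Poisson (lambda k j * s) for type j *)
  bp_mark_law : forall (u : label K) (A : set R) (n : 'I_K -> nat),
    measurable A ->
    bp_prob (mark_event bp_life bp_kids u A [set n]) =
    (\int[if u is [::] then F0 else F (label_type i u)]_(s in A)
      (\prod_(j < K) poisson_mass (lambda (label_type i u) j * s) (n j))%:E)%E ;
  (* the marks of distinct labels are mutually independent *)
  bp_mark_indep : forall (us : seq (label K)) (A : label K -> set R)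
      (C : label K -> set ('I_K -> nat)),
    uniq us -> (forall u, measurable (A u)) ->
    bp_prob (\big[setI/setT]_(u <- us)
               mark_event bp_life bp_kids u (A u) (C u)) =
    (\prod_(u <- us) bp_prob (mark_event bp_life bp_kids u (A u) (C u)))%E
}.

Arguments bp_prob {R K lambda F i F0} b.
Arguments bp_life {R K lambda F i F0} b u w.
Arguments bp_kids {R K lambda F i F0} b u j w.

(* Sum of the lifetimes of all individuals ever born, possibly +oo. *)
Definition busy_period (R : realType) (K : nat)
    (lambda : 'I_K -> 'I_K -> R) (F : 'I_K -> probability (measurableTypeR R) R)
    (i : 'I_K) (F0 : probability (measurableTypeR R) R)
    (B : branching_process lambda F i F0) (w : bp_space B) : \bar R :=
  (\esum_(u in [set u | label_born (fun v j => bp_kids B v j w) u])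
     (bp_life B u w)%:E)%E.

(* E[exp (- theta B)], read as a real number: for theta >= 0 the integrand lies
   in [0, 1].  When theta = 0 the integrand is 1 even where B = +oo. *)
Definition busy_lst (R : realType) (K : nat)
    (lambda : 'I_K -> 'I_K -> R) (F : 'I_K -> probability (measurableTypeR R) R)
    (i : 'I_K) (F0 : probability (measurableTypeR R) R)
    (B : branching_process lambda F i F0) (theta : R) : R :=
  fine (\int[bp_prob B]_w expeR (- (theta%:E * busy_period w)))%E.

(* Extended-real valued, since it may be +oo at negative arguments. *)
Definition service_lst (R : realType)
    (Fi : probability (measurableTypeR R) R) (u : R) : \bar R :=
  (\int[Fi]_(t in `[0%R, +oo[) (expR (- (u * t)))%:E)%E.

Definition busy_exponent (R : realType) (K : nat)
    (lambda : 'I_K -> 'I_K -> R) (g : 'I_K -> R -> R) (i : 'I_K) (theta : R)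
    : R :=
  theta + \sum_(j < K) lambda i j - \sum_(j < K) lambda i j * g j theta.

Definition solves_busy_system (R : realType) (K : nat)
    (lambda : 'I_K -> 'I_K -> R) (F : 'I_K -> probability (measurableTypeR R) R)
    (g : 'I_K -> R -> R) : Prop :=
  forall (i : 'I_K) (theta : R), 0 <= theta ->
    ((g i theta)%:E = service_lst (F i) (busy_exponent lambda g i theta))%E.

Definition nonneg_nonincreasing (R : realType) (K : nat) (g : 'I_K -> R -> R)
    : Prop :=
  forall i : 'I_K,
    (forall theta, 0 <= theta -> 0 <= g i theta) /\
    (forall theta theta', 0 <= theta -> theta <= theta' ->
       g i theta' <= g i theta).

(* Main.v *)
(* Let x = theta + sum_j lambda_ij (1 - g_j) be the argument of psi_i.
   If phi_n is the transform of the total lifetime of the first n generations,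
   conditioning on the mark of the ancestor gives phi_(n+1) = psi(x(phi_n)), and
   phi_n decreases to g by dominated convergence, whence both formulas.
   Minimality: let h be another solution and d = max(0, g - h) at a fixed theta.
   Since 1 - e^(-c S) <= c S, strictly when c S > 0, one gets d_i < (M d)_i
   wherever d_i > 0; if d <> 0 this forces M to have a real eigenvalue > 1. *)

Require Import Defs.
From mathcomp Require Import all_boot all_order all_algebra.
From mathcomp Require Import all_classical all_reals all_analysis.
From mathcomp Require Import measurable_realfun.
From mathcomp Require Import complex ring lra.

Set Implicit Arguments.
Unset Strict Implicit.
Unset Printing Implicit Defensive.

Import Order.TTheory GRing.Theory Num.Theory.
Import numFieldNormedType.Exports.
Import HBNNSimple.

Local Open Scope classical_set_scope.
Local Open Scope ring_scope.

(** No subtree is therefore treated as a branching process of its own. Instead, expectations of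
    products of e^(-theta life) 1{kids = k} are computed over finite sets of labels, the offspring
    counts being capped at N so that only finite sums occur. The law F0 of the ancestor is kept
    arbitrary throughout, so that one limit argument serves both formulas, with F0 = F i and with F0
    a point mass at s.

    In the minimality part, strictness is what settles the critical case: d <= M d is compatible
    with spectral radius 1, but strictness on the finite set where d > 0 yields some r > 1 with r d
    <= M d. Nothing bounds h by 1 from the outset, so its argument x may be negative; the transforms
    are compared at x(g) + c with c >= 0 instead. *)

(** * Linear algebra: subinvariant vectors and the spectral radius *)

(* (resolvent_num M i).[x] / (char_poly M).[x] is entry i of (x - M)^-1 1. *)
Definition resolvent_num (R : realType) (K : nat) (M : 'M[R]_K) (i : 'I_K)
    : {poly R} := \sum_j (\adj (char_poly_mx M)) i j.

(** Sum of row i of (X - M) adj(X - M) = det(X - M) I, evaluated at x. Nothing is divided by the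
    characteristic polynomial yet, so x may be an eigenvalue. *)
Lemma resolvent_numE (R : realType) (K : nat) (M : 'M[R]_K) (i : 'I_K) (x : R) :
  x * (resolvent_num M i).[x] =
    \sum_j M i j * (resolvent_num M j).[x] + (char_poly M).[x].
Proof.
have E : \sum_k (char_poly_mx M *m \adj (char_poly_mx M)) i k = char_poly M.
  rewrite mul_mx_adj (bigD1 i) //= big1 ?addr0 ?mxE ?eqxx ?mulr1n //.
  by move=> k ki; rewrite !mxE eq_sym (negbTE ki).
have {}E : \sum_j (char_poly_mx M) i j * resolvent_num M j = char_poly M.
  rewrite -E; under [RHS]eq_bigr do rewrite mxE.
  rewrite exchange_big /=; apply: eq_bigr => j _.
  by rewrite /resolvent_num mulr_sumr.
rewrite -E (horner_sum _ _ (fun j => char_poly_mx M i j * resolvent_num M j)).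
rewrite -big_split /=.
transitivity (\sum_j (x *+ (i == j)) * (resolvent_num M j).[x]).
  rewrite (bigD1 i) //= eqxx mulr1n big1 ?addr0// => j ji.
  by rewrite eq_sym (negbTE ji) mulr0n mul0r.
apply: eq_bigr => j _; rewrite hornerM !mxE -mulrDl; congr (_ * _).
by case: (i == j); rewrite ?mulr1n ?mulr0n !hornerE
  -[RHS]/(_ + _ - _) addrAC subrr add0r.
Qed.

(* For x above the spectrum, u x = (x - M)^-1 1 solves x u = M u + 1.  It is
   positive for large x, and a component cannot reach 0 as x decreases, since
   u >= 0 forces x u >= 1; so u > 0 down to x = r, and u r compared with d
   contradicts r d <= M d. *)
Lemma eigenvalue_ge_subinvariant (R : realType) (K : nat) (M : 'M[R]_K)
    (d : 'I_K -> R) (r : R) (i0 : 'I_K) :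
  (forall i j, 0 <= M i j) -> (forall i, 0 <= d i) -> 0 < d i0 -> 0 < r ->
  (forall i, r * d i <= \sum_j M i j * d j) ->
  exists2 x : R, r <= x & eigenvalue M x.
Proof.
move=> M0 d0 di0 r0 Md; apply: contrapT => /forall2NP noeig.
have q0 x : r <= x -> (char_poly M).[x] != 0.
  move=> rx; apply/negP => qx; case: (noeig x) => // -[].
  by rewrite eigenvalue_root_char.
pose u i x := (resolvent_num M i).[x] / (char_poly M).[x].
have uE i x : r <= x -> x * u i x = \sum_j M i j * u j x + 1.
  move=> /q0 qx; rewrite /u mulrA resolvent_numE mulrDl divff //; congr (_ + _).
  by rewrite mulr_suml; apply: eq_bigr => j _; rewrite mulrA.
have uC i x : r <= x -> {for x, continuous (u i)}.
  move=> /q0 qx; apply: cvgM; first exact: continuous_horner.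
  by apply: cvgV => //; exact: continuous_horner.
have Mu_ge0 i x : (forall j, 0 <= u j x) -> 0 <= \sum_j M i j * u j x.
  by move=> ux; apply: sumr_ge0 => j _; rewrite mulr_ge0.
have ugt0 x : r <= x -> (forall i, 0 <= u i x) -> forall i, 0 < u i x.
  move=> rx ux i; rewrite lt0r ux andbT; apply/negP => /eqP ui0.
  have := uE i x rx; rewrite ui0 mulr0 => /eqP; rewrite lt_eqF //.
  by rewrite ltr_wpDl// Mu_ge0.
(* [C] dominates every row sum. Beyond it, the equation at the smallest component [m] gives (x - row
   sum) u_m >= 1, so even u_m is nonnegative. *)
pose C := \sum_i \sum_j M i j.
have ubig x : r <= x -> C < x -> forall i, 0 <= u i x.
  move=> rx Cx i.
  have [m _ mP] := arg_minP (fun i => u i x) (i0 := i0) (P := xpredT) isT.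
  apply: le_trans (mP i isT).
  have Cm : \sum_j M m j <= C.
    rewrite /C [leRHS](bigD1 m) //= lerDl; apply: sumr_ge0 => k _.
    by apply: sumr_ge0.
  have : 1 <= (x - \sum_j M m j) * u m x.
    rewrite mulrBl lerBrDr (uE m x rx) addrC lerD2r mulr_suml.
    by apply: ler_sum => j _; rewrite ler_wpM2l ?mP.
  have y0 : 0 < x - \sum_j M m j by rewrite subr_gt0 (le_lt_trans Cm).
  by move=> /(lt_le_trans ltr01); rewrite pmulr_rgt0// => /ltW.
have main x : r <= x -> forall i, 0 <= u i x.
  move=> rx; apply: contrapT => /existsNP[i ui].
  pose S := [set y : R | r <= y /\ exists i, u i y < 0].
  have Sx : S x by split=> //; exists i; rewrite ltNge; apply/negP.
  have Sub : ubound S (Num.max r C).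
    move=> y [ry [j uj]]; rewrite le_max; apply/orP; right.
    by rewrite leNgt; apply/negP => Cy; have := ubig y ry Cy j; rewrite leNgt uj.
  have hS : has_sup S by split; [exists x | exists (Num.max r C)].
  have xs : x <= sup S by apply: ub_le_sup => //; exists (Num.max r C).
  have rs : r <= sup S by exact: le_trans xs.
  (* A negative component at [sup S] would stay negative slightly to the right, beyond the supremum.
     So all components are nonnegative there, positive by [ugt0], and positive nearby, against the
     points of [S] close to [sup S]. *)
  have us j : 0 <= u j (sup S).
    rewrite leNgt; apply/negP => uj.
    have /nbhs_ballP[e /= e0 be] : \forall y \near sup S, u j y < 0.
      by apply: (cvgr_lt _ (uC j _ rs)).
    have /be/= : ball (sup S) e (sup S + e / 2).
      rewrite /ball/= opprD addNKr normrN gtr0_norm ?divr_gt0//.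
      by rewrite ltr_pdivrMr// ltr_pMr// ltr1n.
    move=> ujs; have /(ub_le_sup _) : S (sup S + e / 2).
      by split; [rewrite (le_trans rs)// lerDl ltW// divr_gt0| exists j].
    by move=> /(_ (ex_intro _ _ Sub)); rewrite gerDl leNgt divr_gt0.
  have /nbhs_ballP[e /= e0 be] : \forall y \near sup S, forall j, 0 < u j y.
    apply: (@filter_forall _ _ (fun j y => 0 < u j y) (nbhs (sup S)) _) => j.
    by apply: (cvgr_gt _ (uC j _ rs)); exact: ugt0.
  have [y [ry [j uj]] ys] := sup_adherent e0 hS.
  have ys' : y <= sup S.
    by apply: ub_le_sup; [exists (Num.max r C)|split=> //; exists j].
  have /be/(_ j) : ball (sup S) e y.
    by rewrite /ball/= ger0_norm ?subr_ge0// ltrBlDl -ltrBlDr.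
  by rewrite ltNge ltW.
have {}main := ugt0 r (lexx r) (main r (lexx r)).
(* With [t] the largest ratio d / u, attained at [m]: r d_m <= (M d)_m <= t (M u)_m = t (r u_m - 1)
   = r d_m - t, impossible for t > 0. *)
have [m _ mP] := arg_maxP (fun i => d i / u i r) (i0 := i0) (P := xpredT) isT.
set t := d m / u m r in mP.
have t0 : 0 < t by apply: lt_le_trans (mP i0 isT); rewrite divr_gt0.
have dt j : d j <= t * u j r by rewrite -ler_pdivrMr//; exact: mP.
have dm : d m = t * u m r by rewrite /t divfK// gt_eqF.
have : \sum_j M m j * d j <= t * \sum_j M m j * u j r.
  rewrite mulr_sumr; apply: ler_sum => j _.
  by rewrite mulrCA ler_wpM2l.
have /eqP := uE m r (lexx r); rewrite -subr_eq => /eqP <-.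
move=> /(le_trans (Md m)); rewrite dm mulrBr mulr1 [t * (r * _)]mulrCA.
by rewrite lerDl oppr_ge0 leNgt t0.
Qed.

(** A [sup] is an upper bound only for a set that is bounded above, so the work is to bound all
    complex eigenvalues: at the largest coordinate of a left eigenvector, the modulus is at most the
    sum of all entries of |M|. *)
Lemma eigenvalue_le_spectral_radius (R : realType) (K : nat) (M : 'M[R]_K)
    (x : R) :
  eigenvalue M x -> x <= spectral_radius M.
Proof.
move=> Mx.
pose S := [set r : R | exists2 z : R[i],
  eigenvalue (map_mx (real_complex R) M) z & r = ComplexField.Normc.normc z].
have nE (z : R[i]) : `|z| = real_complex R (ComplexField.Normc.normc z) by [].
suff [C Cub] : exists C, ubound S C.
  have : S `|x|.
    exists (real_complex R x); first by rewrite eigenvalue_map.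
    by rewrite /ComplexField.Normc.normc /= expr0n addr0 sqrtr_sqr.
  move=> /(ub_le_sup (ex_intro _ _ Cub)); exact/le_trans/ler_norm.
exists (\sum_i \sum_j `|M i j|) => r [z /eigenvalueP[v vM v0] ->].
have /rV0Pn[k vk] := v0.
have [m _ mP] := arg_maxP (fun i => ComplexField.Normc.normc (v 0 i))
  (i0 := k) (P := xpredT) isT.
have {}mP i : `|v 0 i| <= `|v 0 m| by rewrite !nE lecR; exact: mP.
have vm0 : 0 < `|v 0 m|.
  by apply: lt_le_trans (mP k); rewrite normr_gt0.
rewrite -lecR -nE -(ler_pM2r vm0) -normrM.
have -> : z * v 0 m = (v *m map_mx (real_complex R) M) 0 m by rewrite vM mxE.
rewrite mxE (le_trans (ler_norm_sum _ _ _))// rmorph_sum mulr_suml.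
apply: ler_sum => i _; rewrite normrM mulrC; apply: ler_pM => //.
rewrite mxE nE /ComplexField.Normc.normc /= expr0n addr0 sqrtr_sqr lecR.
by rewrite [leRHS](bigD1 m) //= lerDl sumr_ge0.
Qed.

(** * Laplace transforms of service times *)

Lemma measurable_expRM (R : realType) (D : set R) (u : R) :
  measurable_fun D (fun t : measurableTypeR R => expR (- (u * t))).
Proof.
apply: measurable_funTS; apply: measurableT_comp => //.
by apply: measurable_funN; exact: mulrl_measurable.
Qed.

Lemma measurable_EFin_expRM (R : realType) (D : set R) (u : R) :
  measurable_fun D (fun t : measurableTypeR R => (expR (- (u * t)))%:E).
Proof. by apply/measurable_EFinP; exact: measurable_expRM. Qed.

Lemma service_lst_ge0 (R : realType) (nu : probability (measurableTypeR R) R)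
  (u : R) : (0 <= service_lst nu u)%E.
Proof. by apply: integral_ge0 => t _; rewrite lee_fin expR_ge0. Qed.

(** Integration over t >= 0 makes this valid for arguments of any sign; the minimality proof applies
    it at possibly negative ones. *)
Lemma service_lst_anti (R : realType) (nu : probability (measurableTypeR R) R)
  (u v : R) : u <= v -> (service_lst nu v <= service_lst nu u)%E.
Proof.
move=> uv; apply: ge0_le_integral => //.
- exact: measurable_EFin_expRM.
- exact: measurable_EFin_expRM.
- move=> t /=; rewrite in_itv/= andbT => t0.
  by rewrite lee_fin ler_expR lerN2 ler_wpM2r.
Qed.

Lemma service_lst_le1 (R : realType) (nu : probability (measurableTypeR R) R)
  (u : R) : 0 <= u -> (service_lst nu u <= 1)%E.
Proof.
move=> /service_lst_anti-/(_ nu) /le_trans; apply.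
rewrite /service_lst; under eq_integral do rewrite mul0r oppr0 expR0.
by rewrite integral_cst//= mul1e probability_le1.
Qed.

Lemma service_lst_fin_num (R : realType)
  (nu : probability (measurableTypeR R) R) (u : R) :
  0 <= u -> service_lst nu u \is a fin_num.
Proof.
move=> u0; rewrite ge0_fin_numE ?service_lst_ge0//.
by rewrite (le_lt_trans (service_lst_le1 nu u0))// ltry.
Qed.

(** Reconciles the mean, an integral over the whole line, with the transform, an integral over the
    half-line. The detour through |t| provides the nonnegative integrand from which a null set can
    be removed. *)
Lemma mean_nonneg_part (R : realType)
  (nu : probability (measurableTypeR R) R) :
  nu [set t : R | t < 0] = 0%E ->
  (\int[nu]_(t in `[0%R, +oo[) t%:E = \int[nu]_t t%:E)%E.
Proof.
move=> nu0.
have mN : measurable ([set t | t < 0] : set (measurableTypeR R)).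
  by rewrite (_ : [set _ | _] = `]-oo, 0%R[%classic).
have DE : `[0%R, +oo[%classic = setT `\` [set t : R | t < 0].
  rewrite seteqP; split => t /=; rewrite in_itv/= andbT.
    by move=> t0; split => //; apply/negP; rewrite -leNgt.
  by move=> -[_ /negP]; rewrite -leNgt.
transitivity (\int[nu]_t `|t|%:E)%E; last first.
  apply: ae_eq_integral => //.
  - by apply/measurable_EFinP; exact: normr_measurable.
  - exists [set t : R | t < 0]; split => //= t.
    move=> /not_implyP[_ tt] /=; rewrite ltNge; apply/negP => t0.
    by apply: tt; rewrite ger0_norm.
rewrite [RHS](ge0_negligible_integral (N := [set t : measurableTypeR R | t < 0]))
  //; last first.
  by apply/measurable_EFinP; exact: normr_measurable.
rewrite -DE; apply: eq_integral => t; rewrite inE/= in_itv/= andbT => t0.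
by rewrite ger0_norm.
Qed.

(** Integrated form of 1 - e^(-c t) <= c t. Equality would force t = 0 almost everywhere, against
    the positive mean. *)
Lemma service_lst_lt (R : realType) (nu : probability (measurableTypeR R) R)
  (m u c : R) :
  nu [set t : R | t < 0] = 0%E -> (\int[nu]_t t%:E = m%:E)%E -> 0 < m ->
  0 <= u -> 0 < c ->
  (service_lst nu u < service_lst nu (u + c) + (c * m)%:E)%E.
Proof.
move=> nu0 num m0 u0 c0; rewrite -mean_nonneg_part// in num.
pose D : set (measurableTypeR R) := `[0%R, +oo[%classic.
have D0 t : D t -> 0 <= t by rewrite /D/= in_itv/= andbT.
have mD : measurable D by exact: measurable_itv.
pose k (t : measurableTypeR R) := expR (- ((u + c) * t)) + c * t - expR (- (u * t)).
(* The first summand is the convexity gap of exp at - c t, which vanishes only at t = 0; the second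
   is a product of two nonnegative factors. *)
have kE t : k t = (expR (- (c * t)) - (1 + - (c * t))) +
    (1 - expR (- (u * t))) * (1 - expR (- (c * t))).
  by rewrite /k mulrDl opprD expRD; ring.
have e1 x t : 0 <= x -> D t -> 0 <= 1 - expR (- (x * t)).
  move=> x0 /D0 t0; rewrite subr_ge0 -[leRHS](expR0 R) ler_expR oppr_le0.
  by rewrite mulr_ge0.
have k0 t : D t -> 0 <= k t.
  move=> Dt; rewrite kE addr_ge0 ?mulr_ge0 ?e1 ?(ltW c0)//.
  by rewrite subr_ge0 expR_ge1Dx.
have mct : measurable_fun D (fun t : measurableTypeR R => c * t).
  by apply: measurable_funTS; exact: mulrl_measurable.
have mk : measurable_fun D k.
  by apply: measurable_funB; [apply: measurable_funD => //|];
    exact: measurable_expRM.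
have kint : (service_lst nu (u + c) + (c * m)%:E =
    \int[nu]_(t in D) (k t)%:E + service_lst nu u)%E.
  rewrite EFinM -num -ge0_integralZl//=; last by rewrite lee_fin ltW.
  rewrite -!ge0_integralD//.
  - by apply: eq_integral => t _; rewrite -EFinM -!EFinD /k subrK.
  - exact/measurable_EFinP.
  - exact: measurable_EFin_expRM.
  - exact: measurable_EFin_expRM.
  - by move=> t /D0 t0; rewrite -EFinM lee_fin mulr_ge0// ltW.
  - exact/measurable_EFinP.
rewrite kint addeC lteDl ?service_lst_fin_num// lt0e; apply/andP; split; last first.
  by apply: integral_ge0 => t /k0; rewrite lee_fin.
apply/eqP => kint0.
have kae : ae_eq nu D (EFin \o k) (cst 0%E).
  apply/ae_eq_integral_abs => //; first exact/measurable_EFinP.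
  rewrite -[RHS]kint0; apply: eq_integral => t; rewrite inE => /k0 kt0.
  by rewrite gee0_abs ?lee_fin.
have : (\int[nu]_(t in D) t%:E = \int[nu]_(t in D) 0)%E.
  apply: ae_eq_integral => //.
  apply: filterS kae => t /= tk Dt; have {tk} := tk Dt.
  move=> [] /eqP; rewrite kE paddr_eq0 ?mulr_ge0 ?e1 ?(ltW c0)//; last first.
    by rewrite subr_ge0 expR_ge1Dx.
  move=> /andP[+ _]; rewrite subr_eq0 => /eqP ct.
  apply/eqP; rewrite eqe; apply/negPn/negP => t0.
  have : - (c * t) != 0 by rewrite oppr_eq0 mulf_neq0// gt_eqF.
  by move=> /expR_gt1Dx; rewrite ct ltxx.
by rewrite integral0 num => -[] /eqP; rewrite gt_eqF.
Qed.

(** * Minimality, by comparison at a fixed theta *)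

Lemma busy_exponent_ge0 (R : realType) (K : nat) (lambda : 'I_K -> 'I_K -> R)
    (g : 'I_K -> R -> R) (i : 'I_K) (theta : R) :
  (forall i j, 0 <= lambda i j) -> 0 <= theta -> (forall j, g j theta <= 1) ->
  0 <= busy_exponent lambda g i theta.
Proof.
move=> l0 th0 g1; rewrite /busy_exponent -addrA addr_ge0// subr_ge0.
by apply: ler_sum => j _; rewrite ler_piMr.
Qed.

Lemma busy_solution_minimal (R : realType) (K : nat)
    (lambda : 'I_K -> 'I_K -> R) (mu : 'I_K -> R)
    (F : 'I_K -> probability (measurableTypeR R) R) (g h : 'I_K -> R -> R)
    (theta : R) :
  (forall i j, 0 <= lambda i j) -> (forall i, 0 < mu i) ->
  (forall i, F i [set t : R | t < 0] = 0%E) ->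
  (forall i, (\int[F i]_t t%:E = (mu i)^-1%:E)%E) ->
  spectral_radius (offspring_mean_mx lambda mu) <= 1 ->
  0 <= theta -> (forall i, g i theta <= 1) ->
  (forall i, (g i theta)%:E =
     service_lst (F i) (busy_exponent lambda g i theta)) ->
  (forall i, (h i theta)%:E =
     service_lst (F i) (busy_exponent lambda h i theta)) ->
  forall i, g i theta <= h i theta.
Proof.
move=> l0 mu0 F0 Fm rad th0 g1 gE hE i0.
rewrite leNgt; apply/negP => hg.
pose M := offspring_mean_mx lambda mu.
pose d i := Num.max 0 (g i theta - h i theta).
have d0 i : 0 <= d i by rewrite le_max lexx.
have di0 : 0 < d i0 by rewrite lt_max subr_gt0 hg orbT.
have M0 i j : 0 <= M i j by rewrite mxE divr_ge0// ltW.
have Md i : 0 < d i -> d i < \sum_j M i j * d j.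
  move=> dpos; have dE : d i = g i theta - h i theta.
    by move: dpos; rewrite /d lt_max ltxx/= => /ltW/max_r.
  rewrite dE.
  pose c := \sum_j lambda i j * d j.
  have -> : \sum_j M i j * d j = c * (mu i)^-1.
    rewrite /c mulr_suml; apply: eq_bigr => j _.
    by rewrite mxE mulrAC.
  have bg0 : 0 <= busy_exponent lambda g i theta by exact: busy_exponent_ge0.
  (* The argument at [h] may be negative; it is only bounded from above, through h_j >= g_j - d_j,
     by a nonnegative one. *)
  have bh : busy_exponent lambda h i theta <= busy_exponent lambda g i theta + c.
    have : \sum_j lambda i j * g j theta <= c + \sum_j lambda i j * h j theta.
      rewrite /c -big_split /=; apply: ler_sum => j _.
      by rewrite -mulrDr ler_wpM2l// -lerBlDr le_max lexx orbT.
    rewrite /busy_exponent; lra.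
  have hc : (service_lst (F i) (busy_exponent lambda g i theta + c)
      <= (h i theta)%:E)%E by rewrite hE service_lst_anti.
  (* For c = 0 monotonicity alone would give g_i <= h_i, against d_i > 0. *)
  have c0 : 0 < c.
    rewrite lt0r; apply/andP; split; last by apply: sumr_ge0 => j _; rewrite mulr_ge0.
    apply/eqP => c0; move: hc; rewrite c0 addr0 -gE lee_fin leNgt => /negP; apply.
    by rewrite -subr_gt0 -dE.
  have := service_lst_lt (F0 i) (Fm i) _ bg0 c0.
  rewrite invr_gt0 mu0 -gE => /(_ isT) /lt_le_trans /(_ (leeD2r _ hc)).
  by rewrite -EFinD lte_fin ltrBlDl.
(* [r] is the least ratio (M d)_i / d_i over the support of [d], hence r > 1. Off the support, r d_i
   = 0 and the bound is trivial. *)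
have [m dm mP] := arg_minP (fun i => (\sum_j M i j * d j) / d i)
  (i0 := i0) (P := fun i => 0 < d i) di0.
set r := (\sum_j M m j * d j) / d m in mP.
have r1 : 1 < r by rewrite ltr_pdivlMr// mul1r Md.
have rd i : r * d i <= \sum_j M i j * d j.
  have [di|] := ltP 0 (d i); first by rewrite -ler_pdivlMr//; exact: mP.
  move=> di; have -> : d i = 0 by apply/eqP; rewrite eq_le di d0.
  by rewrite mulr0 sumr_ge0// => j _; rewrite mulr_ge0.
have [x rx /eigenvalue_le_spectral_radius xr] :=
  eigenvalue_ge_subinvariant M0 d0 di0 (lt_trans ltr01 r1) rd.
by move: (lt_le_trans r1 (le_trans rx (le_trans xr rad))); rewrite ltxx.
Qed.

(** * Measurability and convergence tools *)

(** Cuts the space along the countably many values of [N]; meant for products over a random number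
    of children. *)
Lemma measurable_fun_comp_nat d (T : measurableType d) (R : realType)
    (N : T -> nat) (f : nat -> T -> R) :
  measurable_fun setT N -> (forall n, measurable_fun setT (f n)) ->
  measurable_fun setT (fun w => f (N w) w).
Proof.
move=> mN mf _ Y mY.
have -> : setT `&` (fun w => f (N w) w) @^-1` Y =
    \bigcup_n ((setT `&` N @^-1` [set n]) `&` (setT `&` f n @^-1` Y)).
  rewrite seteqP; split => w /=; first by move=> [_ Yw]; exists (N w).
  by move=> [n _ [[_ /= ->] [_ ?]]].
by apply: bigcup_measurable => n _; apply: measurableI; [exact: mN|exact: mf].
Qed.

Lemma bounded_cvg_integral d (T : measurableType d) (R : realType)
    (P : probability T R) (D : set T) (f_ : nat -> T -> R) (f : T -> \bar R) :
  measurable D -> (forall n, measurable_fun D (f_ n)) ->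
  (forall n w, D w -> 0 <= f_ n w <= 1) ->
  (forall w, D w -> ((f_ n w)%:E @[n --> \oo] --> f w)%E) ->
  ((\int[P]_(w in D) (f_ n w)%:E)%E @[n --> \oo] --> (\int[P]_(w in D) f w)%E)%E.
Proof.
move=> mD mf f01 ff; apply: (@dominated_cvg _ _ _ _ _ mD _ _ (cst 1%E)) => //.
- by move=> n; exact/measurable_EFinP.
- apply/integrableP; split; first exact: measurable_cst.
  under eq_integral do rewrite abse1.
  by rewrite integral_cst// mul1e (le_lt_trans (probability_le1 _ mD))// ltry.
- by move=> n w /f01-/(_ n)/andP[f0 f1]; rewrite gee0_abs lee_fin.
Qed.

(* Two weighted laws that agree on indicators agree on nonnegative functions;
   this replaces image measures with a density. *)
Lemma eq_weighted_integral d1 d2 (T1 : measurableType d1)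
    (T2 : measurableType d2) (R : realType) (P1 : {measure set T1 -> \bar R})
    (P2 : {measure set T2 -> \bar R})
    (X1 : T1 -> measurableTypeR R) (X2 : T2 -> measurableTypeR R)
    (H1 : T1 -> R) (H2 : T2 -> R) (f : measurableTypeR R -> R) :
  measurable_fun setT X1 -> measurable_fun setT X2 ->
  measurable_fun setT H1 -> measurable_fun setT H2 ->
  (forall w, 0 <= H1 w) -> (forall w, 0 <= H2 w) ->
  measurable_fun setT f -> (forall s, 0 <= f s) ->
  (forall A : set (measurableTypeR R), measurable A ->
    \int[P1]_w (H1 w * \1_A (X1 w))%:E = \int[P2]_w (H2 w * \1_A (X2 w))%:E)%E ->
  (\int[P1]_w (H1 w * f (X1 w))%:E = \int[P2]_w (H2 w * f (X2 w))%:E)%E.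
Proof.
move=> mX1 mX2 mH1 mH2 H10 H20 mf f0 eqA.
have mEf : measurable_fun setT (EFin \o f) by exact/measurable_EFinP.
pose f_ := nnsfun_approx measurableT mEf.
have f_cvg d (T : measurableType d) (P : {measure set T -> \bar R})
    (X : T -> measurableTypeR R) (H : T -> R) :
    measurable_fun setT X -> measurable_fun setT H -> (forall w, 0 <= H w) ->
    ((\int[P]_w (H w * f_ n (X w))%:E)%E @[n --> \oo] -->
     (\int[P]_w (H w * f (X w))%:E)%E).
  move=> mX mH H0.
  have lim w : (H w * f_ n (X w))%:E @[n --> \oo] --> (H w * f (X w))%:E.
    apply: cvg_EFin; first exact: nearW.
    apply: cvgMr; have /fine_cvgP[_] := cvg_nnsfun_approx measurableT mEf
      (fun x _ => f0 x : (0 <= (f x)%:E)%E) (I : setT (X w)).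
    exact.
  rewrite [X in _ --> X](_ : _ =
      \int[P]_w (limn (fun n => (H w * f_ n (X w))%:E)))%E; last first.
    by apply: eq_integral => w _; apply/esym/cvg_lim.
  apply: (@cvg_monotone_convergence _ _ _ P setT measurableT
    (fun n w => (H w * f_ n (X w))%:E)).
  - move=> n; apply/measurable_EFinP; apply: measurable_funM => //.
    exact: measurableT_comp.
  - by move=> n w _; rewrite lee_fin mulr_ge0.
  - move=> w _ n m nm; rewrite lee_fin ler_wpM2l//.
    exact/lefP/nd_nnsfun_approx.
suff fE n : (\int[P1]_w (H1 w * f_ n (X1 w))%:E =
             \int[P2]_w (H2 w * f_ n (X2 w))%:E)%E.
  have := f_cvg _ _ P1 X1 H1 mX1 mH1 H10; under eq_fun do rewrite fE.
  by move=> c1; apply: (cvg_unique _ c1 (f_cvg _ _ P2 X2 H2 mX2 mH2 H20)).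
(* The absolute value makes every summand nonnegative for arbitrary y, as the exchange of sum and
   integral demands; on the range of [f_ n] it changes nothing. *)
have sumE d (T : measurableType d) (P : {measure set T -> \bar R})
    (X : T -> measurableTypeR R) (H : T -> R) :
    measurable_fun setT X -> measurable_fun setT H -> (forall w, 0 <= H w) ->
    (\int[P]_w (H w * f_ n (X w))%:E =
     \sum_(y <- finmap.enum_fset (fset_set (range (f_ n)))) \int[P]_w
       (`|y|%:E * (H w * \1_(f_ n @^-1` [set y]) (X w))%:E))%E.
  move=> mX mH H0; rewrite -ge0_integral_sum//.
  - apply: eq_integral => w _.
    rewrite sumEFin fimfunE fsbig_finite//= mulr_sumr; congr EFin.
    apply: eq_big_seq => y; rewrite in_fset_set// inE => -[x _ <-].
    by rewrite ger0_norm// mulrCA.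
  - move=> y; apply: emeasurable_funM => //; apply/measurable_EFinP.
    by apply: measurable_funM => //; apply: measurableT_comp.
  - by move=> y w _; rewrite lee_fin !mulr_ge0.
rewrite !sumE//; apply: eq_bigr => y _.
have mT d (T : measurableType d) (X : T -> measurableTypeR R) (H : T -> R) :
    measurable_fun setT X -> measurable_fun setT H ->
    measurable_fun setT (fun w => (H w * \1_(f_ n @^-1` [set y]) (X w))%:E).
  move=> mX mH; apply/measurable_EFinP; apply: measurable_funM => //.
  by apply: measurableT_comp.
rewrite !ge0_integralZl_EFin ?eqA//.
- by move=> w _; rewrite lee_fin mulr_ge0.
- exact: mT.
- by move=> w _; rewrite lee_fin mulr_ge0.
- exact: mT.
Qed.

(** * Offspring lists, truncated transforms and Poisson generating functions *)

Definition offspring (K : nat) (k : 'I_K -> nat) (u : label K) : seq (label K) :=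
  [seq (j, m) :: u | j <- index_enum 'I_K, m <- iota 0 (k j)].

Lemma offspringP (K : nat) (k : 'I_K -> nat) (u v : label K) :
  reflect (exists j m, v = (j, m) :: u /\ (m < k j)%N) (v \in offspring k u).
Proof.
apply: (iffP allpairsPdep) => [[j [m [_]]]|[j [m [-> mk]]]].
  by rewrite mem_iota add0n => /andP[_ mk ->]; exists j, m.
by exists j, m; rewrite mem_index_enum mem_iota.
Qed.

Lemma offspring_uniq (K : nat) (k : 'I_K -> nat) (u : label K) :
  uniq (offspring k u).
Proof.
apply: allpairs_uniq_dep; first exact: index_enum_uniq.
  by move=> j _; exact: iota_uniq.
by move=> [j m] [j' m'] _ _ /= [-> ->].
Qed.

Lemma big_offspring (R : Type) (idx : R) (op : Monoid.law idx) (K : nat)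
    (k : 'I_K -> nat) (u : label K) (f : label K -> R) :
  \big[op/idx]_(v <- offspring k u) f v =
  \big[op/idx]_(j < K) \big[op/idx]_(m < k j) f ((j, m : nat) :: u).
Proof.
rewrite big_allpairs_dep; apply: eq_bigr => j _.
by rewrite -[X in iota 0 X]subn0 -/(index_iota _ _) big_mkord.
Qed.

Lemma prodr_itv01 (R : realDomainType) (I : Type) (s : seq I) (f : I -> R) :
  (forall i, 0 <= f i <= 1) -> 0 <= \prod_(i <- s) f i <= 1.
Proof.
move=> f01; elim/big_ind: _ => // [|x y /andP[x0 x1] /andP[y0 y1]].
  by rewrite ler01 lexx.
by rewrite mulr_ge0// mulr_ile1.
Qed.

(** This is exp(- theta T), with T the total lifetime in [n] generations counted from [u], which is
    treated as born. The product form suits the induction over marks; [lst_uptoE] returns to the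
    sum. *)
Fixpoint lst_upto (R : realType) (K : nat) (lambda : 'I_K -> 'I_K -> R)
    (F : 'I_K -> probability (measurableTypeR R) R) (i : 'I_K)
    (F0 : probability (measurableTypeR R) R)
    (B : branching_process lambda F i F0) (theta : R) (n : nat) (u : label K)
    (w : bp_space B) : R :=
  if n is n'.+1 then
    expR (- (theta * bp_life B u w)) *
      \prod_(v <- offspring (bp_kids B u ^~ w) u) lst_upto theta n' v w
  else 1.

(** Successive approximations started from 1, the transform of an empty total. For nonnegative rates
    and theta they stay in [0, 1], so the arguments stay nonnegative and [fine] loses nothing. *)
Fixpoint lst_iter (R : realType) (K : nat) (lambda : 'I_K -> 'I_K -> R)
    (F : 'I_K -> probability (measurableTypeR R) R) (theta : R) (n : nat)
    (j : 'I_K) : R :=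
  if n is n'.+1 then
    fine (service_lst (F j)
      (busy_exponent lambda (fun k _ => lst_iter lambda F theta n' k) j theta))
  else 1.

Lemma lst_iter_itv01 (R : realType) (K : nat) (lambda : 'I_K -> 'I_K -> R)
    (F : 'I_K -> probability (measurableTypeR R) R) (theta : R) (n : nat)
    (j : 'I_K) :
  (forall i j, 0 <= lambda i j) -> 0 <= theta ->
  0 <= lst_iter lambda F theta n j <= 1.
Proof.
move=> l0 th0; elim: n j => [|n IHn] j /=; first by rewrite ler01 lexx.
have b0 : 0 <= busy_exponent lambda
    (fun k _ => lst_iter lambda F theta n k) j theta.
  by apply: busy_exponent_ge0 => // k; have /andP[] := IHn k.
by rewrite -!lee_fin fineK ?service_lst_fin_num// service_lst_ge0 service_lst_le1.
Qed.

Lemma poisson_mass_ge0 (R : realType) (r : R) (k : nat) :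
  0 <= r -> 0 <= poisson_mass r k.
Proof. by move=> r0; rewrite mulr_ge0 ?expR_ge0// divr_ge0// exprn_ge0. Qed.

Lemma poisson_gen_cvg (R : realType) (r z : R) :
  \sum_(k < N) poisson_mass r k * z ^+ k @[N --> \oo] --> expR (r * z - r).
Proof.
rewrite expRD.
have -> : (fun N => \sum_(k < N) poisson_mass r k * z ^+ k) =
    (fun N => series (exp_coeff (r * z)) N * expR (- r)).
  apply/funext => N; rewrite /series/= big_mkord mulr_suml.
  by apply: eq_bigr => k _; rewrite /poisson_mass /exp_coeff/= exprMn; ring.
by apply: cvgMl; exact: is_cvg_series_exp_coeff.
Qed.

(** Partial sums of nonnegative terms increase to exp(r (z - 1)) <= 1. This is the bound used for
    dominated convergence. *)
Lemma poisson_gen_itv01 (R : realType) (r z : R) (N : nat) :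
  0 <= r -> 0 <= z <= 1 -> 0 <= \sum_(k < N) poisson_mass r k * z ^+ k <= 1.
Proof.
move=> r0 /andP[z0 z1].
have t0 k : 0 <= poisson_mass r k * z ^+ k.
  by rewrite mulr_ge0 ?poisson_mass_ge0// exprn_ge0.
rewrite sumr_ge0//=; apply: (@le_trans _ _ (expR (r * z - r))); last first.
  by rewrite -[leRHS](expR0 R) ler_expR subr_le0 ler_piMr.
have c := @poisson_gen_cvg R r z.
rewrite -(cvg_lim _ c)//; apply: (nondecreasing_cvgn_le _ (cvgP _ c)) => n m nm.
rewrite -(big_mkord xpredT (fun k => poisson_mass r k * z ^+ k)).
rewrite -(big_mkord xpredT (fun k => poisson_mass r k * z ^+ k)).
by rewrite (big_cat_nat (leq0n _) nm)//= lerDl sumr_ge0.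
Qed.

(** * The recursion for truncated transforms, from the laws and independence of marks *)

Section BranchingRecursion.
Context (R : realType) (K : nat) (lambda : 'I_K -> 'I_K -> R)
  (F : 'I_K -> probability (measurableTypeR R) R) (i : 'I_K)
  (F0 : probability (measurableTypeR R) R)
  (B : branching_process lambda F i F0) (theta : R).
Hypothesis lambda_ge0 : forall i j, 0 <= lambda i j.
Hypothesis theta_ge0 : 0 <= theta.

Local Notation P := (bp_prob B).
Local Notation life := (bp_life B).
Local Notation kids := (bp_kids B).
Local Notation Y := (@lst_upto _ _ _ _ _ _ B theta).
Local Notation phi := (lst_iter lambda F theta).

Let label_law (u : label K) : probability (measurableTypeR R) R :=
  if u is [::] then F0 else F (label_type i u).

(** Lifetime and offspring counts of one label are dependent, so they are revealed together. *)
Let mark (k : 'I_K -> nat) (u : label K) (w : bp_space B) : R :=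
  expR (- (theta * life u w)) * \1_(mark_event life kids u setT [set k]) w.

Let mark_mean (k : 'I_K -> nat) (u : label K) : R :=
  fine (\int[P]_w (mark k u w)%:E)%E.

Let measurable_mark_event u A k :
  measurable A -> measurable (mark_event life kids u A [set k]).
Proof.
move=> mA.
have -> : mark_event life kids u A [set k] =
    (setT `&` life u @^-1` A) `&`
      \bigcap_(j in [set: 'I_K]) (setT `&` kids u j @^-1` [set k j]).
  rewrite seteqP; split => w /=; rewrite /mark_event/=.
    by move=> [Al <-]; split => // j.
  by move=> [[_ Al] kE]; split => //; apply/funext => j; have [] := kE j I.
apply: measurableI; first exact: bp_life_measurable.
by apply: fin_bigcap_measurable => // j _; exact: bp_kids_measurable.
Qed.

Let prob_mark_event u A k : measurable A ->
  (P (mark_event life kids u A [set k]) = \int[label_law u]_(s in A)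
     (\prod_(j < K) poisson_mass (lambda (label_type i u) j * s) (k j))%:E)%E.
Proof. by move=> mA; have := bp_mark_law B u k mA; case: u. Qed.

Let measurable_disc u : measurable_fun setT (fun w => expR (- (theta * life u w))).
Proof.
apply: (@measurableT_comp _ _ _ _ _ _ (fun t => expR (- (theta * t)))).
  exact: measurable_expRM.
exact: bp_life_measurable.
Qed.

Let disc_itv01 u w : 0 <= expR (- (theta * life u w)) <= 1.
Proof.
rewrite expR_ge0/= -[leRHS](expR0 R) ler_expR oppr_le0.
by rewrite mulr_ge0 ?bp_life_ge0.
Qed.

Let measurable_mark k u : measurable_fun setT (mark k u).
Proof.
apply: measurable_funM; first exact: measurable_disc.
by apply: measurable_indic; exact: measurable_mark_event.
Qed.

Let mark_itv01 k u w : 0 <= mark k u w <= 1.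
Proof.
have /andP[d0 d1] := disc_itv01 u w.
by rewrite /mark indicE; case: (w \in _); rewrite ?mulr1 ?mulr0 ?d0 ?d1 ?lexx ?ler01.
Qed.

Let integral_itv01 (f : bp_space B -> R) : measurable_fun setT f ->
  (forall w, 0 <= f w <= 1) -> (\int[P]_w (f w)%:E)%E \is a fin_num /\
  0 <= fine (\int[P]_w (f w)%:E)%E.
Proof.
move=> mf f01.
have f0 : (0 <= \int[P]_w (f w)%:E)%E.
  by apply: integral_ge0 => w _; rewrite lee_fin; have /andP[] := f01 w.
split; last exact: fine_ge0.
rewrite ge0_fin_numE// (@le_lt_trans _ _ 1%E) ?ltry//.
apply: (@le_trans _ _ (\int[P]_w cst 1 w)%E); last first.
  by rewrite integral_cst//= mul1e probability_le1.
apply: ge0_le_integral => //.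
- by move=> w _; rewrite lee_fin; have /andP[] := f01 w.
- exact/measurable_EFinP.
- by move=> w _; rewrite lee_fin; have /andP[] := f01 w.
Qed.

Let integral_mark k u : (\int[P]_w (mark k u w)%:E)%E = (mark_mean k u)%:E.
Proof.
by rewrite fineK//; have [] := integral_itv01 (measurable_mark k u) (mark_itv01 k u).
Qed.

Let mark_mean_ge0 k u : 0 <= mark_mean k u.
Proof. by have [] := integral_itv01 (measurable_mark k u) (mark_itv01 k u). Qed.

Let prob_event_fin u A k : measurable A ->
  (fine (P (mark_event life kids u A [set k])))%:E =
  P (mark_event life kids u A [set k]).
Proof.
by move=> mA; rewrite fineK// fin_num_measure//; exact: measurable_mark_event.
Qed.

(** The law of a mark is prescribed on events only. Weighting by the indicator of the counts on one
    side and by the Poisson masses on the other turns it into a statement about e^(-theta s). *)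
Let mark_meanE k u : ((mark_mean k u)%:E =
  \int[label_law u]_(s in `[0%R, +oo[) (expR (- (theta * s)) *
    \prod_j poisson_mass (lambda (label_type i u) j * s) (k j))%:E)%E.
Proof.
rewrite -integral_mark.
pose D : set (measurableTypeR R) := `[0%R, +oo[%classic.
have mD : measurable D by exact: measurable_itv.
pose q (s : measurableTypeR R) : R :=
  \prod_j poisson_mass (lambda (label_type i u) j * s) (k j).
have mq : measurable_fun setT q.
  apply: measurable_prod => j _; apply: measurable_funM.
    apply: measurable_funM => //; apply: measurable_funX.
    exact: mulrl_measurable.
  exact: measurable_expRM.
have q0 s : D s -> 0 <= q s.
  rewrite /D/= in_itv/= andbT => s0.
  by apply: prodr_ge0 => j _; rewrite poisson_mass_ge0// mulr_ge0.
transitivity (\int[label_law u]_s ((q s * \1_D s) * expR (- (theta * s)))%:E)%E;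
    last first.
  rewrite [RHS]integral_mkcond/=; apply: eq_integral => s _.
  by rewrite patchE indicE; case: ifPn => _; rewrite ?mulr0 ?mul0r// mulr1 mulrC.
transitivity (\int[P]_w (\1_(mark_event life kids u setT [set k]) w *
    expR (- (theta * life u w)))%:E)%E.
  by apply: eq_integral => w _; rewrite mulrC.
apply: (@eq_weighted_integral _ _ _ _ R P (label_law u) (life u) idfun
  _ _ (fun s => expR (- (theta * s)))) => //.
- exact: bp_life_measurable.
- exact: measurable_id.
- by apply: measurable_indic; exact: measurable_mark_event.
- by apply: measurable_funM => //; exact: measurable_indic.
- move=> s; rewrite indicE; case: (boolP (s \in D)); rewrite ?mulr0// mulr1 inE.
  exact: q0.
- exact: measurable_expRM.
- move=> A mA.
  (* Lifetimes are nonnegative everywhere, so intersecting with [D] leaves the event unchanged, and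
     on [D] the Poisson weights are nonnegative. *)
  have mAD : measurable (A `&` D) by exact: measurableI.
  transitivity (P (mark_event life kids u (A `&` D) [set k])).
    rewrite -[mark_event _ _ _ _ _ in RHS]setIT -integral_indic//; last first.
      exact: measurable_mark_event.
    apply: eq_integral => w _; congr EFin.
    rewrite !indicE -natrM mulnb; congr (nat_of_bool _)%:R.
    apply/andP/idP; rewrite !inE.
      by move=> [[_ kE] Al]; do !split => //; rewrite /D/= in_itv/= bp_life_ge0.
    by move=> [[Al Dl] kE].
  transitivity (\int[label_law u]_(s in A `&` D) (q s)%:E)%E.
    exact: prob_mark_event.
  rewrite [LHS]integral_mkcond/=; apply: eq_integral => s _.
  rewrite patchE -mulrA indicE indicE -natrM mulnb -in_setI setIC.
  by case: ifPn => _; rewrite ?mulr1 ?mulr0.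
Qed.

(** Independence is given for events, but is needed for transforms. The induction converts one label
    at a time; keeping arbitrary events on [vs2] lets the label being converted be tested against
    every lifetime set. *)
Let integral_marks_mixed (vs1 vs2 : seq (label K)) (kappa : label K -> 'I_K -> nat)
    (A : label K -> set R) :
  uniq (vs1 ++ vs2) -> (forall u, measurable (A u)) ->
  (\int[P]_w (\prod_(v <- vs1) mark (kappa v) v w *
     \prod_(v <- vs2) \1_(mark_event life kids v (A v) [set kappa v]) w)%:E =
   (\prod_(v <- vs1) mark_mean (kappa v) v *
    \prod_(v <- vs2) fine (P (mark_event life kids v (A v) [set kappa v])))%:E)%E.
Proof.
elim: vs1 vs2 A => [|x vs1 IHvs] vs2 A.
  move=> /= u2 mA; under eq_integral do rewrite big_nil mul1r.
  rewrite big_nil mul1r.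
  transitivity (P (\big[setI/setT]_(v <- vs2)
      mark_event life kids v (A v) [set kappa v])).
    rewrite -[in RHS](setIT (\big[_/_]_(_ <- _) _)) -integral_indic//; last first.
      by apply: bigsetI_measurable => v _; exact: measurable_mark_event.
    apply: eq_integral => w _; congr EFin.
    elim: vs2 {u2} => [|v vs IH]; first by rewrite !big_nil indicT.
    by rewrite !big_cons indicI IH.
  rewrite (@bp_mark_indep _ _ _ _ _ _ B _ _ (fun u => [set kappa u]))// -prodEFin.
  by apply: eq_bigr => v _; rewrite prob_event_fin.
rewrite cat_cons => u12 mA.
pose c := \prod_(v <- vs1) mark_mean (kappa v) v *
    \prod_(v <- vs2) fine (P (mark_event life kids v (A v) [set kappa v])).
have c0 : 0 <= c.
  by rewrite mulr_ge0// prodr_ge0// => v _; rewrite ?mark_mean_ge0// fine_ge0.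
pose E := mark_event life kids x setT [set kappa x].
have mE : measurable E by exact: measurable_mark_event.
pose H (w : bp_space B) : R := \1_E w * (\prod_(v <- vs1) mark (kappa v) v w *
  \prod_(v <- vs2) \1_(mark_event life kids v (A v) [set kappa v]) w).
transitivity (\int[P]_w (H w * expR (- (theta * life x w)))%:E)%E.
  apply: eq_integral => w _; congr EFin.
  by rewrite big_cons /H /mark -/E; ring.
transitivity (\int[P]_w ((c * \1_E w) * expR (- (theta * life x w)))%:E)%E; last first.
  under eq_integral do rewrite -mulrA (mulrC (\1_E _)) EFinM.
  rewrite ge0_integralZl_EFin//.
  - by rewrite integral_mark -EFinM big_cons mulrC -mulrA.
  - by apply/measurable_EFinP; exact: measurable_mark.
apply: (@eq_weighted_integral _ _ _ _ R P P (life x) (life x)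
  _ _ (fun s => expR (- (theta * s)))) => //.
- exact: bp_life_measurable.
- exact: bp_life_measurable.
- apply: measurable_funM; first exact: measurable_indic.
  apply: measurable_funM; apply: measurable_prod => v _.
    exact: measurable_mark.
  by apply: measurable_indic; exact: measurable_mark_event.
- by apply: measurable_funM => //; exact: measurable_indic.
- move=> w; apply: mulr_ge0 => //; apply: mulr_ge0; apply: prodr_ge0 => v _ //.
  by have /andP[] := mark_itv01 (kappa v) v w.
- by move=> w; rewrite mulr_ge0.
- exact: measurable_expRM.
(* On an indicator test function, [x] joins the event list with lifetime set [A0], which is the
   induction hypothesis. *)
- move=> A0 mA0.
  pose A' v := if v == x then A0 else A v.
  have mA' v : measurable (A' v) by rewrite /A'; case: (v == x) => //; exact: mA.
  have xE w : \1_E w * \1_A0 (life x w) =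
      \1_(mark_event life kids x (A' x) [set kappa x]) w :> R.
    rewrite /A' eqxx !indicE -natrM mulnb; congr (nat_of_bool _)%:R.
    apply/andP/idP; rewrite !inE.
      by move=> [[_ ?] ?].
    by move=> [? ?].
  have u12' : uniq (vs1 ++ x :: vs2).
    by rewrite -cat1s uniq_catCA.
  have A'E v : v \in vs2 -> A' v = A v.
    move=> vvs; rewrite /A'; case: eqP => // vx; move: u12.
    by rewrite /= mem_cat -vx vvs orbT.
  have := IHvs (x :: vs2) A' u12' mA'; rewrite !big_cons => IH.
  transitivity (c%:E * P (mark_event life kids x (A' x) [set kappa x]))%E.
    rewrite -(prob_event_fin x (kappa x) (mA' x)) -EFinM mulrC.
    have -> : c = \prod_(v <- vs1) mark_mean (kappa v) v *
        \prod_(v <- vs2) fine (P (mark_event life kids v (A' v) [set kappa v])).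
      by congr (_ * _); apply: eq_big_seq => v /A'E ->.
    rewrite mulrCA -IH; apply: eq_integral => w _; congr EFin.
    have E2 : \prod_(v <- vs2) \1_(mark_event life kids v (A v) [set kappa v]) w =
        \prod_(v <- vs2) \1_(mark_event life kids v (A' v) [set kappa v]) w :> R.
      by apply: eq_big_seq => v /A'E ->.
    rewrite big_cons -xE /H E2; ring.
  under [RHS]eq_integral do rewrite -mulrA xE EFinM.
  have mA'x := measurable_mark_event x (kappa x) (mA' x).
  rewrite ge0_integralZl_EFin//; last first.
    by apply/measurable_EFinP; exact: measurable_indic.
  by rewrite integral_indic ?setIT.
Qed.


(** A variant of [phi] indexed by labels, because the root alone has lifetime law [F0]. *)
Let label_lst (n : nat) (u : label K) : R :=
  if n is n'.+1 then
    fine (service_lst (label_law u)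
      (busy_exponent lambda (fun j _ => phi n' j) (label_type i u) theta))
  else 1.

Lemma lst_upto_itv01 n u w : 0 <= Y n u w <= 1.
Proof.
elim: n u => [|n IHn] u /=; first by rewrite ler01 lexx.
have /andP[d0 d1] := disc_itv01 u w.
have /andP[p0 p1] := prodr_itv01 (offspring (kids u ^~ w) u) IHn.
by rewrite mulr_ge0// mulr_ile1.
Qed.

Lemma measurable_lst_upto n u : measurable_fun setT (Y n u).
Proof.
elim: n u => [|n IHn] u /=; first exact: measurable_cst.
apply: measurable_funM; first exact: measurable_disc.
rewrite (_ : (fun w => _) = (fun w =>
    \prod_j \prod_(m < kids u j w) Y n ((j, m : nat) :: u) w)); last first.
  by apply/funext => w; rewrite big_offspring.
apply: measurable_prod => j _.
apply: (measurable_fun_comp_nat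
  (f := fun N w => \prod_(m < N) Y n ((j, m : nat) :: u) w)).
  exact: bp_kids_measurable.
by move=> N; apply: measurable_prod => m _.
Qed.

(* At most N - 1 children of each type: keeps the sum over offspring counts
   finite until N tends to infinity. *)
Let lst_upto_trunc (N n : nat) (u : label K) (w : bp_space B) : R :=
  \sum_(f : {ffun 'I_K -> 'I_N}) mark (fun j => f j) u w *
    \prod_(v <- offspring (fun j => f j) u) Y n v w.

Let lst_upto_truncE N n u w : lst_upto_trunc N n u w =
  if [forall j, (kids u j w < N)%N] then Y n.+1 u w else 0.
Proof.
have mark0 (f : {ffun 'I_K -> 'I_N}) j : kids u j w != f j ->
    mark (fun j => f j) u w = 0.
  move=> kf; rewrite /mark indicE memNset ?mulr0// => -[_ /= kE].
  by move: kf; rewrite -(congr1 (@^~ j) kE) eqxx.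
case: ifPn => [/forallP kN|/forallPn[j kj]]; last first.
  apply: big1 => f _; rewrite (mark0 _ j) ?mul0r//.
  by apply: contra kj => /eqP ->; exact: ltn_ord.
rewrite /lst_upto_trunc (bigD1 [ffun j => Ordinal (kN j)])//= [X in _ + X]big1 ?addr0.
  have fE : (fun j => [ffun j => Ordinal (kN j)] j : nat) = kids u ^~ w.
    by apply/funext => j; rewrite ffunE.
  by rewrite fE /mark indicE mem_set ?mulr1//; split.
move=> f /eqP fE; apply/eqP; rewrite mulf_eq0; apply/orP; left.
have /existsP[j kj] : [exists j, kids u j w != f j].
  apply: contra_notT fE => /existsPn kE; apply/ffunP => j; apply: val_inj.
  by rewrite ffunE /=; have /negPn/eqP := kE j.
by rewrite (mark0 f j).
Qed.

Let label_lst_child n j m u : label_lst n ((j, m) :: u) = phi n j.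
Proof. by case: n. Qed.

(** The sum over offspring vectors factors into partial sums of Poisson generating functions under
    the lifetime integral. Their limits exp(r_j (phi_j - 1)) merge with e^(-theta s) into the
    transform at the busy exponent. *)
Let mark_sum_cvg n u :
  \sum_(f : {ffun 'I_K -> 'I_N}) mark_mean (fun j => f j) u *
    \prod_(v <- offspring (fun j => f j) u) label_lst n v @[N --> \oo]
  --> label_lst n.+1 u.
Proof.
pose D : set (measurableTypeR R) := `[0%R, +oo[%classic.
have mD : measurable D by exact: measurable_itv.
have D0 s : D s -> 0 <= s by rewrite /D/= in_itv/= andbT.
pose r j s := lambda (label_type i u) j * s.
have r0 j s : D s -> 0 <= r j s by move=> /D0 s0; rewrite mulr_ge0.
have mp j k : measurable_fun D (fun s : measurableTypeR R => poisson_mass (r j s) k).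
  apply: measurable_funTS; apply: measurable_funM.
    apply: measurable_funM => //; apply: measurable_funX.
    exact: mulrl_measurable.
  exact: measurable_expRM.
pose h N (s : measurableTypeR R) := expR (- (theta * s)) *
  \prod_j \sum_(k < N) poisson_mass (r j s) k * phi n j ^+ k.
have phi01 j : 0 <= phi n j <= 1 by exact: lst_iter_itv01.
have phi0 j : 0 <= phi n j by have /andP[] := phi01 j.
have sumE N : (\sum_(f : {ffun 'I_K -> 'I_N}) mark_mean (fun j => f j) u *
    \prod_(v <- offspring (fun j => f j) u) label_lst n v)%:E =
    (\int[label_law u]_(s in D) (h N s)%:E)%E.
  have hE s : h N s = \sum_(f : {ffun 'I_K -> 'I_N})
      (expR (- (theta * s)) * \prod_j poisson_mass (r j s) (f j)) *
      \prod_j phi n j ^+ f j.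
    rewrite /h bigA_distr_bigA mulr_sumr; apply: eq_bigr => f _.
    by rewrite big_split mulrA.
  under [RHS]eq_integral do rewrite hE -sumEFin.
  rewrite ge0_integral_sum//.
  - rewrite -sumEFin; apply: eq_bigr => f _.
    have -> : \prod_(v <- offspring (fun j => f j) u) label_lst n v =
        \prod_j phi n j ^+ f j.
      rewrite big_offspring; apply: eq_bigr => j _.
      under eq_bigr do rewrite label_lst_child.
      by rewrite prodr_const card_ord.
    rewrite EFinM mark_meanE; under [RHS]eq_integral do rewrite EFinM.
    rewrite ge0_integralZr//.
    + apply/measurable_EFinP; apply: measurable_funM.
        exact: measurable_expRM.
      by apply: measurable_prod => j _.
    + move=> s /r0 rs; rewrite lee_fin mulr_ge0 ?expR_ge0// prodr_ge0// => j _.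
      by rewrite poisson_mass_ge0.
    + by rewrite lee_fin prodr_ge0// => j _; rewrite exprn_ge0.
  - move=> f; apply/measurable_EFinP; apply: measurable_funM => //.
    apply: measurable_funM; first exact: measurable_expRM.
    by apply: measurable_prod => j _.
  - move=> f s /r0 rs; rewrite lee_fin !mulr_ge0 ?expR_ge0// prodr_ge0// => j _.
      by rewrite poisson_mass_ge0.
    by rewrite exprn_ge0.
suff /fine_cvgP[_] : (\sum_(f : {ffun 'I_K -> 'I_N}) mark_mean (fun j => f j) u *
    \prod_(v <- offspring (fun j => f j) u) label_lst n v)%:E @[N --> \oo]
    --> (label_lst n.+1 u)%:E by [].
under eq_fun do rewrite sumE.
rewrite /label_lst fineK; last first.
  apply: service_lst_fin_num; apply: busy_exponent_ge0 => // j.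
  by have /andP[] := phi01 j.
apply: bounded_cvg_integral => //.
- move=> N; apply: measurable_funM; first exact: measurable_expRM.
  apply: measurable_prod => j _; apply: measurable_sum => k.
  exact: measurable_funM.
- move=> N s Ds.
  have p01 j : 0 <= \sum_(k < N) poisson_mass (r j s) k * phi n j ^+ k <= 1.
    by apply: poisson_gen_itv01 => //; exact: r0.
  have /andP[p0 p1] := prodr_itv01 (index_enum 'I_K) p01.
  rewrite mulr_ge0 ?expR_ge0//= mulr_ile1 ?expR_ge0//.
  by rewrite -[leRHS](expR0 R) ler_expR oppr_le0 mulr_ge0// D0.
- move=> s Ds; apply: cvg_EFin; first exact: nearW.
  have -> : expR (- (busy_exponent lambda (fun j _ => phi n j)
      (label_type i u) theta * s)) =
      expR (- (theta * s)) * \prod_j expR (r j s * phi n j - r j s).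
    rewrite -expR_sum -expRD; congr expR.
    have -> : \sum_j (r j s * phi n j - r j s) =
        (\sum_j lambda (label_type i u) j * phi n j) * s -
        (\sum_j lambda (label_type i u) j) * s.
      rewrite sumrB !mulr_suml; congr (_ - _).
      by apply: eq_bigr => j _; rewrite /r mulrAC.
    by rewrite /busy_exponent; ring.
  apply: cvgMr; apply: cvg_big => [|j _]; first exact: mul_continuous.
  exact: poisson_gen_cvg.
Qed.


(* Breadth-first induction: us1 and us0 are the pending labels of generations
   L and L + 1, and the parents of us0 are all among the labels vs whose marks
   are prescribed; revealing the mark of u in us1 moves u to vs and adds its
   children to us0. *)
Let integral_marks_lst_upto n : forall (L : nat) (vs us : seq (label K))
    (kappa : label K -> 'I_K -> nat),
  uniq (vs ++ us) ->
  (forall v, v \in vs -> (size (v : seq _) <= L)%N) ->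
  (forall u, u \in us -> size (u : seq _) = L) ->
  (\int[P]_w (\prod_(v <- vs) mark (kappa v) v w * \prod_(u <- us) Y n u w)%:E =
   (\prod_(v <- vs) mark_mean (kappa v) v *
    \prod_(u <- us) label_lst n u)%:E)%E.
Proof.
elim: n => [|n IHn] L vs us kappa.
  rewrite cat_uniq => /andP[uvs _] _ _.
  have uvs0 : uniq (vs ++ [::]) by rewrite cats0.
  have := integral_marks_mixed kappa uvs0 (fun=> @measurableT _ (measurableTypeR R)).
  rewrite !big_nil => IH; rewrite [X in _ * X]big1// -IH.
  by apply: eq_integral => w _; rewrite big_nil [X in _ * X]big1.
(* Labels in [us1] have n + 1 generations left and those in [us0] have n, so both are cut off at the
   same absolute depth. *)
suff bfs us1 us0 : uniq (vs ++ us1) -> uniq us0 ->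
    (forall v, v \in vs -> (size (v : seq _) <= L)%N) ->
    (forall u, u \in us1 -> size (u : seq _) = L) ->
    (forall u, u \in us0 -> size (u : seq _) = L.+1 /\ behead u \in vs) ->
    (\int[P]_w (\prod_(v <- vs) mark (kappa v) v w *
       (\prod_(u <- us1) Y n.+1 u w * \prod_(u <- us0) Y n u w))%:E =
     (\prod_(v <- vs) mark_mean (kappa v) v *
       (\prod_(u <- us1) label_lst n.+1 u *
        \prod_(u <- us0) label_lst n u))%:E)%E.
  move=> uvus vsL usL; have := bfs us [::] uvus isT vsL usL.
  rewrite big_nil mulr1 => <- //.
  by apply: eq_integral => w _; rewrite big_nil mulr1.
(* Once generation L is used up, [us0] becomes the pending list at level L + 1; its labels are
   longer than all those in [vs], hence disjoint from them. *)
elim: us1 us0 vs kappa {us} => [|u us1 IHus] us0 vs kappa.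
  rewrite cats0 => uvs uus0 vsL _ us0L.
  have uvus0 : uniq (vs ++ us0).
    rewrite cat_uniq uvs uus0 andbT/=; apply/hasPn => v /us0L[vL _].
    by apply/negP => /vsL; rewrite vL ltnn.
  have := IHn L.+1 vs us0 kappa uvus0 (fun v vvs => leqW (vsL v vvs))
    (fun v vus0 => proj1 (us0L v vus0)).
  rewrite big_nil mul1r => <-.
  by apply: eq_integral => w _; rewrite big_nil mul1r.
move=> uvus uus0 vsL us1L us0L.
pose G (w : bp_space B) := \prod_(v <- vs) mark (kappa v) v w *
  (\prod_(u <- us1) Y n.+1 u w * \prod_(u <- us0) Y n u w).
pose c := \prod_(v <- vs) mark_mean (kappa v) v *
  (\prod_(u <- us1) label_lst n.+1 u * \prod_(u <- us0) label_lst n u).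
have G01 w : 0 <= G w <= 1.
  have /andP[m0 m1] := prodr_itv01 vs (fun v => mark_itv01 (kappa v) v w).
  have /andP[y0 y1] := prodr_itv01 us1 (fun u => lst_upto_itv01 n.+1 u w).
  have /andP[z0 z1] := prodr_itv01 us0 (fun u => lst_upto_itv01 n u w).
  by rewrite !mulr_ge0//= !mulr_ile1 ?mulr_ge0.
have mG : measurable_fun setT G.
  apply: measurable_funM; [|apply: measurable_funM]; apply: measurable_prod => v _.
  - exact: measurable_mark.
  - exact: measurable_lst_upto.
  - exact: measurable_lst_upto.
have mchild k : measurable_fun setT
    (fun w => mark k u w * \prod_(v <- offspring k u) Y n v w).
  apply: measurable_funM; first exact: measurable_mark.
  by apply: measurable_prod => v _; exact: measurable_lst_upto.
have child0 k w : 0 <= mark k u w * \prod_(v <- offspring k u) Y n v w.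
  rewrite mulr_ge0//; first by have /andP[] := mark_itv01 k u w.
  by have /andP[] := prodr_itv01 (offspring k u) (fun v => lst_upto_itv01 n v w).
have uvs : u \notin vs.
  by move: uvus; rewrite -cat1s uniq_catCA /= mem_cat negb_or => /andP[/andP[]].
have stepN N : (\int[P]_w (G w * lst_upto_trunc N n u w)%:E =
    (c * \sum_(f : {ffun 'I_K -> 'I_N}) mark_mean (fun j => f j) u *
      \prod_(v <- offspring (fun j => f j) u) label_lst n v)%:E)%E.
  under eq_integral do rewrite mulr_sumr -sumEFin.
  rewrite ge0_integral_sum//; last 2 first.
  - by move=> f; apply/measurable_EFinP; apply: measurable_funM.
  - by move=> f w _; rewrite lee_fin mulr_ge0//; have /andP[] := G01 w.
  rewrite mulr_sumr -sumEFin; apply: eq_bigr => f _.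
  pose k (j : 'I_K) : nat := f j.
  pose kappa' v := if v == u then k else kappa v.
  have kappa'E v : v \in vs -> kappa' v = kappa v.
    by move=> vvs; rewrite /kappa'; case: eqP => // vu; move: uvs; rewrite -vu vvs.
  have us1u : size (u : seq _) = L by apply: us1L; rewrite mem_head.
  have := IHus (offspring k u ++ us0) (u :: vs) kappa'.
  rewrite !big_cons !big_cat /= /kappa' eqxx => IH.
  transitivity (\int[P]_w (mark k u w * \prod_(v <- vs) mark (kappa v) v w *
      (\prod_(u <- us1) Y n.+1 u w *
       (\prod_(v <- offspring k u) Y n v w * \prod_(u <- us0) Y n u w)))%:E)%E.
    by apply: eq_integral => w _; congr EFin; rewrite /G -/k; ring.
  transitivity ((mark_mean k u * \prod_(v <- vs) mark_mean (kappa v) v *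
      (\prod_(u <- us1) label_lst n.+1 u *
       (\prod_(v <- offspring k u) label_lst n v *
        \prod_(u <- us0) label_lst n u)))%:E); last first.
    by congr EFin; rewrite /c -/k; ring.
  rewrite (eq_big_seq (fun v => mark_mean (kappa' v) v)); last first.
    by move=> v /kappa'E ->.
  rewrite -IH.
  - apply: eq_integral => w _; rewrite !big_cons big_cat /= eqxx; congr (_ * _ * _)%:E.
    by apply: eq_big_seq => v /kappa'E; rewrite /kappa' => ->.
  - by move: uvus; rewrite -cat1s uniq_catCA.
  (* The children of [u] are new: the parents of [us0] lie in [vs], and [u] does not. *)
  - rewrite cat_uniq offspring_uniq uus0 andbT/=; apply/hasPn => v /us0L[_ bv].
    by apply/negP => /offspringP[j [m [vE _]]]; move: bv; rewrite vE (negbTE uvs).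
  - by move=> v; rewrite in_cons => /predU1P[->|/vsL//]; rewrite us1u.
  - by move=> v vus1; apply: us1L; rewrite in_cons vus1 orbT.
  - move=> v; rewrite mem_cat => /orP[/offspringP[j [m [-> _]]]|/us0L[vL bv]].
      by rewrite /= us1u mem_head.
    by rewrite vL in_cons bv orbT.
have cvL : (\int[P]_w (G w * lst_upto_trunc N n u w)%:E)%E @[N --> \oo] -->
    (\int[P]_w (G w * Y n.+1 u w)%:E)%E.
  apply: bounded_cvg_integral => //.
  - move=> N; apply: measurable_funM => //; apply: measurable_sum => f.
    exact: mchild.
  - move=> N w _; have /andP[G0 G1] := G01 w.
    have /andP[y0 y1] := lst_upto_itv01 n.+1 u w.
    rewrite lst_upto_truncE; case: ifP => _; rewrite ?mulr0 ?lexx ?ler01//.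
    by rewrite mulr_ge0// mulr_ile1.
  (* For fixed [w] the truncation is exact once N exceeds every offspring count of [u]. *)
  - move=> w _; apply: cvg_near_cst.
    exists (\max_j kids u j w).+1 => // N /= mN.
    rewrite lst_upto_truncE ifT//; apply/forallP => j.
    by apply: leq_ltn_trans mN; apply: (leq_bigmax (F := fun j => kids u j w)).
have cvR : (\int[P]_w (G w * lst_upto_trunc N n u w)%:E)%E @[N --> \oo] -->
    (c * label_lst n.+1 u)%:E.
  under eq_fun do rewrite stepN.
  apply: cvg_EFin; first exact: nearW.
  by apply: cvgMr; exact: mark_sum_cvg.
transitivity (\int[P]_w (G w * Y n.+1 u w)%:E)%E.
  by apply: eq_integral => w _; congr EFin; rewrite /G big_cons; ring.
rewrite (cvg_unique _ cvL cvR)//; congr EFin.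
by rewrite /c big_cons; ring.
Qed.

Lemma integral_lst_upto n : (\int[P]_w (Y n.+1 [::] w)%:E =
  service_lst F0 (busy_exponent lambda (fun j _ => phi n j) i theta))%E.
Proof.
have := @integral_marks_lst_upto n.+1 0 [::] [:: [::]] (fun _ _ => 0%N) isT.
rewrite !big_nil !big_seq1 mul1r => IH.
transitivity (label_lst n.+1 [::])%:E.
  rewrite -IH//; last by move=> u; rewrite inE => /eqP ->.
  by apply: eq_integral => w _; rewrite big_nil big_seq1 mul1r.
rewrite /label_lst fineK// service_lst_fin_num// busy_exponent_ge0// => j.
by have /andP[] := lst_iter_itv01 F n j lambda_ge0 theta_ge0.
Qed.

End BranchingRecursion.

(** * The busy period as the limit of lifetimes summed over finitely many generations *)

Fixpoint born_upto (K : nat) (kids : label K -> 'I_K -> nat) (n : nat)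
    (u : label K) : seq (label K) :=
  if n is n'.+1 then
    u :: [seq v | c <- offspring (kids u) u, v <- born_upto kids n' c]
  else [::].

Lemma born_upto_cat (K : nat) (kids : label K -> 'I_K -> nat) (n : nat)
    (u v : label K) :
  v \in born_upto kids n u ->
  exists p : label K, [/\ v = p ++ u, (size p < n)%N &
    (label_born kids u -> label_born kids v)].
Proof.
elim: n u v => // n IHn u v; rewrite in_cons => /predU1P[->|]; first by exists [::].
move=> /allpairsPdep[c [v' [cu /IHn[p [-> pn bornp]] ->]]].
have /offspringP[j [m [cE mk]]] := cu.
exists (rcons p (j, m)); rewrite size_rcons cat_rcons -cE; split=> // bu.
by apply: bornp; rewrite cE /= bu.
Qed.

Lemma label_born_cat (K : nat) (kids : label K -> 'I_K -> nat) (p u : label K) :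
  label_born kids (p ++ u) -> label_born kids u.
Proof. by elim: p => //= -[j m] p IHp /andP[/IHp]. Qed.

Lemma mem_born_upto (K : nat) (kids : label K -> 'I_K -> nat) (n : nat)
    (p u : label K) :
  (size (p : seq _) < n)%N -> label_born kids (p ++ u) ->
  p ++ u \in born_upto kids n u.
Proof.
(* Labels are youngest first, so the last entry of [p] is the child of [u] through which the descent
   passes. *)
elim: n p u => // n IHn p u; case/lastP: p => [|p [j m]].
  by rewrite mem_head.
rewrite size_rcons ltnS cat_rcons => pn bp.
have /= /andP[_ mk] := label_born_cat bp.
rewrite in_cons; apply/orP; right; apply/allpairsPdep.
exists ((j, m) :: u), (p ++ (j, m) :: u); split => //.
  by apply/offspringP; exists j, m.
exact: IHn.
Qed.

(** Subtrees of distinct siblings are disjoint: a common label would have both siblings as suffixes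
    of the same length. *)
Lemma born_upto_uniq (K : nat) (kids : label K -> 'I_K -> nat) (n : nat)
    (u : label K) : uniq (born_upto kids n u).
Proof.
elim: n u => // n IHn u /=; apply/andP; split.
  apply/negP => /allpairsPdep[c [v [/offspringP[j [m [-> _]]]
    /born_upto_cat[p [-> _ _]] /(congr1 size)]]].
  by rewrite size_cat addnS -addSn -[LHS]add0n => /eqP; rewrite eqn_add2r.
apply: allpairs_uniq_dep; [exact: offspring_uniq | by move=> c _; exact: IHn |].
move=> _ _ /allpairsPdep[c [v [cu vc ->]]] /allpairsPdep[c' [v' [cu' vc' ->]]] /= vv'.
subst v'; suff -> : c = c' by [].
have /offspringP[j [m [cE _]]] := cu; have /offspringP[j' [m' [cE' _]]] := cu'.
have [p [vE _ _]] := born_upto_cat vc; have [p' [vE' _ _]] := born_upto_cat vc'.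
have /eqP := vE'; rewrite vE eqseq_cat; first by move=> /andP[_ /eqP].
have /eqP := congr1 size vE'; rewrite vE !size_cat cE cE' /= eqn_add2r.
by move=> /eqP.
Qed.

Lemma lst_uptoE (R : realType) (K : nat) (lambda : 'I_K -> 'I_K -> R)
    (F : 'I_K -> probability (measurableTypeR R) R) (i : 'I_K)
    (F0 : probability (measurableTypeR R) R)
    (B : branching_process lambda F i F0) (theta : R) (n : nat) (u : label K)
    (w : bp_space B) :
  lst_upto theta n u w = expR (- (theta *
    \sum_(v <- born_upto (fun v j => bp_kids B v j w) n u) bp_life B v w)).
Proof.
elim: n u => [|n IHn] u /=; first by rewrite big_nil mulr0 oppr0 expR0.
under eq_bigr do rewrite IHn.
rewrite -expR_sum -expRD big_cons mulrDr opprD; congr expR; congr (_ + _).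
by rewrite [in RHS]big_allpairs_dep sumrN -mulr_sumr.
Qed.

Lemma busy_period_cvg (R : realType) (K : nat) (lambda : 'I_K -> 'I_K -> R)
    (F : 'I_K -> probability (measurableTypeR R) R) (i : 'I_K)
    (F0 : probability (measurableTypeR R) R)
    (B : branching_process lambda F i F0) (w : bp_space B) :
  ((\sum_(v <- born_upto (fun v j => bp_kids B v j w) n [::])
      bp_life B v w)%:E @[n --> \oo] --> busy_period w)%E.
Proof.
pose kids v j := bp_kids B v j w.
pose X n := [set` born_upto kids n [::]].
pose S n : \bar R := (\sum_(v \in X n) (bp_life B v w)%:E)%E.
have SE n : (\sum_(v <- born_upto kids n [::]) bp_life B v w)%:E = S n.
  by rewrite /S /X -sumEFin fsbig_seq// born_upto_uniq.
under eq_fun do rewrite SE.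
have finX n : finite_set (X n) by exact: finite_seq.
have Xborn n : X n `<=` [set u | label_born kids u].
  by move=> v /= /born_upto_cat[p [_ _]]; exact.
have bornX n v : label_born kids v -> (size (v : seq _) < n)%N -> X n v.
  by move=> bv vn; rewrite /X/= -[v]cats0; apply: mem_born_upto => //; rewrite cats0.
have Ssub (A C : set (label K)) : finite_set A -> finite_set C -> A `<=` C ->
    (\sum_(v \in A) (bp_life B v w)%:E <= \sum_(v \in C) (bp_life B v w)%:E)%E.
  move=> fA fC AC; apply: lee_fsum_nneg_subset => //.
    by move=> v; rewrite !inE; exact: AC.
  by move=> v _; rewrite lee_fin bp_life_ge0.
have Snd : {homo S : n m / (n <= m)%N >-> (n <= m)%E}.
  move=> n m nm; apply: Ssub => // v Xv.
  apply: bornX; first exact: Xborn Xv.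
  have [p [-> pn _]] := born_upto_cat Xv.
  by rewrite cats0 (leq_trans pn).
rewrite (_ : busy_period w = ereal_sup (range S)).
  exact: ereal_nondecreasing_cvgn.
apply/eqP; rewrite eq_le; apply/andP; split; apply: ge_ereal_sup.
  move=> _ [A [fA Aborn] <-].
  (* One more than the longest label in [A], so that n generations contain all of [A]. *)
  pose n := (\max_(v <- finmap.enum_fset (fset_set A)) size (v : seq _)).+1.
  apply: (@le_trans _ _ (S n)); last by apply: ereal_sup_ubound; exists n.
  apply: Ssub => // v Av; apply: bornX; first exact: Aborn.
  by rewrite ltnS; apply: leq_bigmax_seq => //; rewrite in_fset_set// inE.
move=> _ [n _ <-]; apply: esum_ge; exists (X n) => //.
Qed.

Lemma busy_period_ge0 (R : realType) (K : nat) (lambda : 'I_K -> 'I_K -> R)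
    (F : 'I_K -> probability (measurableTypeR R) R) (i : 'I_K)
    (F0 : probability (measurableTypeR R) R)
    (B : branching_process lambda F i F0) (w : bp_space B) :
  (0 <= busy_period w)%E.
Proof. by apply: esum_ge0 => v _; rewrite lee_fin bp_life_ge0. Qed.

(** The case theta = 0 is separate, since 0 times +oo is 0 and the limit is then 1; for theta > 0 an
    infinite busy period gives the limit 0. *)
Lemma lst_upto_cvg (R : realType) (K : nat) (lambda : 'I_K -> 'I_K -> R)
    (F : 'I_K -> probability (measurableTypeR R) R) (i : 'I_K)
    (F0 : probability (measurableTypeR R) R)
    (B : branching_process lambda F i F0) (theta : R) (w : bp_space B) :
  0 <= theta ->
  ((lst_upto theta n [::] w)%:E @[n --> \oo] -->
    expeR (- (theta%:E * busy_period w)))%E.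
Proof.
move=> th0; under eq_fun do rewrite lst_uptoE.
have := @busy_period_cvg R K lambda F i F0 B w.
have [<-|thN0] := eqVneq 0 theta.
  move=> _; rewrite mul0e oppe0 expeR0.
  under eq_fun do rewrite mul0r oppr0 expR0.
  exact: cvg_cst.
have thpos : 0 < theta by rewrite lt0r eq_sym thN0.
have := busy_period_ge0 w; case: (busy_period w) =>
  [b _ /fine_cvgP[_ Sb]|_ /cvgeryP Sy|//].
  apply: cvg_EFin; first exact: nearW.
  apply: (continuous_cvg _ (@continuous_expR R _)).
  by apply: cvgN; apply: cvgMr.
rewrite gt0_muley ?lte_fin//=.
apply: cvg_EFin; first exact: nearW.
apply: (cvg_comp _ _ _ (@cvgr_expR R)).
move: Sy => /cvgryPge Sy; apply/cvgryPge => A.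
by apply: filterS (Sy (A / theta)) => n; rewrite ler_pdivrMr// mulrC.
Qed.

Lemma measurable_busy_integrand (R : realType) (K : nat)
    (lambda : 'I_K -> 'I_K -> R)
    (F : 'I_K -> probability (measurableTypeR R) R) (i : 'I_K)
    (F0 : probability (measurableTypeR R) R)
    (B : branching_process lambda F i F0) (theta : R) :
  0 <= theta ->
  measurable_fun setT (fun w : bp_space B => expeR (- (theta%:E * busy_period w)))%E.
Proof.
move=> th0; apply: (@emeasurable_fun_cvg _ _ _ _
  (fun n w => (lst_upto theta n [::] w)%:E)).
  by move=> n; apply/measurable_EFinP; exact: measurable_lst_upto.
by move=> w _; exact: lst_upto_cvg.
Qed.

Lemma busy_integral_le1 (R : realType) (K : nat) (lambda : 'I_K -> 'I_K -> R)
    (F : 'I_K -> probability (measurableTypeR R) R) (i : 'I_K)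
    (F0 : probability (measurableTypeR R) R)
    (B : branching_process lambda F i F0) (theta : R) :
  0 <= theta ->
  (\int[bp_prob B]_w expeR (- (theta%:E * busy_period w)) <= 1)%E.
Proof.
move=> th0; apply: (@le_trans _ _ (\int[bp_prob B]_w cst 1 w)%E); last first.
  by rewrite integral_cst//= mul1e probability_le1.
apply: ge0_le_integral => //.
- by move=> w _; exact: expeR_ge0.
- exact: measurable_busy_integrand.
- move=> w _; rewrite -expeR0 lee_expeR oppe_le0 mule_ge0//.
  exact: busy_period_ge0.
Qed.

Lemma busy_lst_EFin (R : realType) (K : nat) (lambda : 'I_K -> 'I_K -> R)
    (F : 'I_K -> probability (measurableTypeR R) R) (i : 'I_K)
    (F0 : probability (measurableTypeR R) R)
    (B : branching_process lambda F i F0) (theta : R) :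
  0 <= theta ->
  ((busy_lst B theta)%:E =
    \int[bp_prob B]_w expeR (- (theta%:E * busy_period w)))%E.
Proof.
move=> th0; rewrite fineK// ge0_fin_numE.
  by rewrite (le_lt_trans (busy_integral_le1 B th0))// ltry.
by apply: integral_ge0 => w _; exact: expeR_ge0.
Qed.

Lemma busy_lst_ge0 (R : realType) (K : nat) (lambda : 'I_K -> 'I_K -> R)
    (F : 'I_K -> probability (measurableTypeR R) R) (i : 'I_K)
    (F0 : probability (measurableTypeR R) R)
    (B : branching_process lambda F i F0) (theta : R) : 0 <= busy_lst B theta.
Proof. by apply/fine_ge0/integral_ge0 => w _; exact: expeR_ge0. Qed.

Lemma busy_lst_anti (R : realType) (K : nat) (lambda : 'I_K -> 'I_K -> R)
    (F : 'I_K -> probability (measurableTypeR R) R) (i : 'I_K)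
    (F0 : probability (measurableTypeR R) R)
    (B : branching_process lambda F i F0) (theta theta' : R) :
  0 <= theta -> theta <= theta' -> busy_lst B theta' <= busy_lst B theta.
Proof.
move=> th0 th01; have th'0 := le_trans th0 th01.
rewrite -lee_fin !busy_lst_EFin//; apply: ge0_le_integral => //.
- by move=> w _; exact: expeR_ge0.
- exact: measurable_busy_integrand.
- exact: measurable_busy_integrand.
- move=> w _; rewrite lee_expeR leeN2 lee_wpmul2r ?lee_fin//.
  exact: busy_period_ge0.
Qed.

Lemma integral_lst_upto_cvg (R : realType) (K : nat)
    (lambda : 'I_K -> 'I_K -> R)
    (F : 'I_K -> probability (measurableTypeR R) R) (i : 'I_K)
    (F0 : probability (measurableTypeR R) R)
    (B : branching_process lambda F i F0) (theta : R) :
  0 <= theta ->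
  (\int[bp_prob B]_w (lst_upto theta n [::] w)%:E)%E @[n --> \oo] -->
    (busy_lst B theta)%:E.
Proof.
move=> th0; rewrite busy_lst_EFin//; apply: bounded_cvg_integral => //.
- by move=> n; exact: measurable_lst_upto.
- by move=> n w _; exact: lst_upto_itv01.
- by move=> w _; exact: lst_upto_cvg.
Qed.

(** * The functional equations and the theorem *)

Section BusyEquation.
Context (R : realType) (K : nat) (lambda : 'I_K -> 'I_K -> R)
  (F : 'I_K -> probability (measurableTypeR R) R)
  (B : forall i, branching_process lambda F i (F i)) (theta : R).
Hypothesis lambda_ge0 : forall i j, 0 <= lambda i j.
Hypothesis theta_ge0 : 0 <= theta.

Lemma lst_iter_cvg (j : 'I_K) :
  lst_iter lambda F theta n j @[n --> \oo] --> busy_lst (B j) theta.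
Proof.
rewrite -cvg_shiftS (_ : [sequence _]_n = fine \o (fun n =>
    \int[bp_prob (B j)]_w (lst_upto theta n.+1 [::] w)%:E)%E); last first.
  by apply/funext => n /=; rewrite integral_lst_upto.
apply: fine_cvg; have := @integral_lst_upto_cvg _ _ _ _ _ _ (B j) _ theta_ge0.
by rewrite -cvg_shiftS.
Qed.

(** One sequence with two limits: over the process the truncated transforms tend to that of the busy
    period, and over [F0] dominated convergence applies because the iterates converge. *)
Lemma busy_lst_service (i : 'I_K) (F0 : probability (measurableTypeR R) R)
    (Bi : branching_process lambda F i F0) :
  ((busy_lst Bi theta)%:E =
    service_lst F0 (busy_exponent lambda (fun j => busy_lst (B j)) i theta))%E.
Proof.
have cB : (fun n => service_lst F0 (busy_exponent lambda
    (fun j _ => lst_iter lambda F theta n j) i theta)) @ \oo -->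
    (busy_lst Bi theta)%:E.
  have := @integral_lst_upto_cvg _ _ _ _ _ _ Bi _ theta_ge0.
  rewrite -cvg_shiftS; under eq_fun do rewrite integral_lst_upto//.
  exact.
apply: (cvg_unique _ cB) => //.
apply: bounded_cvg_integral => //.
- by move=> n; exact: measurable_expRM.
- move=> n s; rewrite /= in_itv/= andbT => s0.
  rewrite expR_ge0/= -[leRHS](expR0 R) ler_expR oppr_le0 mulr_ge0//.
  apply: busy_exponent_ge0 => // j.
  by have /andP[] := lst_iter_itv01 F n j lambda_ge0 theta_ge0.
- move=> s _; apply: cvg_EFin; first exact: nearW.
  apply: (continuous_cvg _ (@continuous_expR R _)).
  apply: cvgN; apply: cvgMl; apply: cvgB; first exact: cvg_cst.
  apply: cvg_big => [|j _]; first exact: add_continuous.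
  by apply: cvgMr; exact: lst_iter_cvg.
Qed.

End BusyEquation.

Theorem theorem11 (R : realType) (K : nat)
    (lambda : 'I_K -> 'I_K -> R) (mu : 'I_K -> R)
    (F : 'I_K -> probability (measurableTypeR R) R)
    (lambda_ge0 : forall i j, 0 <= lambda i j)
    (mu_gt0 : forall i, 0 < mu i)
    (F_ge0 : forall i, F i [set t : R | t < 0] = 0%E)
    (F_mean : forall i, (\int[F i]_t t%:E = (mu i)^-1%:E)%E)
    (M_irreducible : irreducible_mx (offspring_mean_mx lambda mu))
    (M_radius : spectral_radius (offspring_mean_mx lambda mu) <= 1)
    (B : forall i, branching_process lambda F i (F i)) :
  let g i theta := busy_lst (B i) theta in
  (forall (i : 'I_K) (s : R)
      (Bs : branching_process lambda F i (@dirac _ (measurableTypeR R) s R))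
      (theta : R), 0 <= s -> 0 <= theta ->
    busy_lst Bs theta = expR (- (s * busy_exponent lambda g i theta))) /\
  solves_busy_system lambda F g /\
  nonneg_nonincreasing g /\
  (forall h : 'I_K -> R -> R,
    nonneg_nonincreasing h -> solves_busy_system lambda F h ->
    forall (i : 'I_K) (theta : R), 0 <= theta -> g i theta <= h i theta).
Proof.
move=> g.
have solves : solves_busy_system lambda F g.
  by move=> i theta th0; exact: busy_lst_service.
have mono : nonneg_nonincreasing g.
  move=> i; split=> [theta _|theta theta' th0]; first exact: busy_lst_ge0.
  exact: busy_lst_anti.
split; last split; last split => //.
- move=> i s Bs theta s0 th0; apply: EFin_inj.
  (* With the ancestor's lifetime law a point mass, the transform is evaluation at [s], which lies
     in the half-line of integration as s >= 0. *)
  rewrite (busy_lst_service B)// /service_lst integral_dirac//; last first.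
    exact: measurable_EFin_expRM.
  by rewrite diracE mem_set ?mul1e 1?mulrC//= in_itv/= s0.
- exact: solves.
- move=> h _ hsolves i theta th0.
  apply: (busy_solution_minimal lambda_ge0 mu_gt0 F_ge0 F_mean M_radius th0) => j.
  + by rewrite -lee_fin busy_lst_EFin// busy_integral_le1.
  + exact: solves.
  + exact: hsolves.
Qed.
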